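(* Let $R(S,\kappa)$ be a near-integral fusion ring. If $d_+\in\mathbb{Z}$, then $\kappa<N$. Moreover, if $\kappa\geq N$, then $d_+$ is irrational.
   Context: A fusion ring $(R,B)$ is a unital associative ring $R$, free as a $\mathbb{Z}$-module with finite basis $B=\{1_R=b_1,\ldots,b_n\}$, such that $b_ib_j=\sum_k c_{ij}^kb_k$ with $c_{ij}^k\in\mathbb{Z}_{\geq0}$, together with an involution $\ast$ of $\{1,\ldots,n\}$ such that $\sum_ja_jb_j\mapsto\sum_ja_jb_{j^\ast}$ is an antiautomorphism of $R$ and $c_{ij}^1=1$ if $i=j^\ast$ and $0$ otherwise. $\mathrm{FPdim}:R\to\mathbb{C}$ is the ring homomorphism sending each $b_i\in B$ to the maximal real eigenvalue of $[c_{ij}^k]_{j,k}$, and $\mathrm{FPdim}(R):=\sum_{b\in B}\mathrm{FPdim}(b)^2$. A fusion subring is a fusion ring $(S,C)$ with $C\subseteq B$ and $S\subseteq R$ the $\mathbb{Z}$-span of $C$. $(R,B)$ is near-integral if it has a fusion subring $(S,C)$ with $|C|+1=|B|$. Then $\rho$ denotes the unique element of $B\setminus C$, $\kappa:=c_{\rho,\rho}^\rho\in\mathbb{Z}_{\geq0}$, $N:=\mathrm{FPdim}(S)$ (a positive integer), $d_+:=\mathrm{FPdim}(\rho)$, and $R$ is denoted $R(S,\kappa)$; its fusion rules are those of $S$ together with $x\rho=\rho x=\mathrm{FPdim}(x)\rho$ for $x\in C$ and $\rho^2=\kappa\rho+\sum_{x\in C}\mathrm{FPdim}(x)x$. In particular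 $d_+$ is the positive root of $x^2-\kappa x-N=0$. *)

(* Defs.v *)
From HB Require Import structures.
From mathcomp Require Import all_boot all_order all_algebra.
From mathcomp Require Import classical_sets reals.

Set Implicit Arguments.
Unset Strict Implicit.
Unset Printing Implicit Defensive.

Import Order.TTheory GRing.Theory Num.Theory.
Local Open Scope ring_scope.

Definition zcomb (R : zmodType) (n : nat) (b : 'I_n -> R)
  (a : {ffun 'I_n -> int}) : R := \sum_j b j *~ a j.

Definition ring_antiautomorphism (R : pzRingType) (f : R -> R) : Prop :=
  [/\ bijective f, {morph f : x y / x + y}, f 1 = 1
    & {morph f : x y / x * y >-> y * x}].

(* A pair (R, B) is a ring R together with a term B : fusionBasis R; the rank
   n = |B| is positive, and the distinguished index of 1_R is ord0.  The
   fields fb_coord, fb_coordK and fb_zcombK say that B is a Z-basis of R;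
   fb_coord, fb_str and fb_star are determined by the family fb_elt. *)
Record fusionBasis (R : nzRingType) := FusionBasis {
  fb_rank1 : nat;
  fb_elt :> 'I_fb_rank1.+1 -> R;
  fb_coord : R -> {ffun 'I_fb_rank1.+1 -> int};
  fb_str : 'I_fb_rank1.+1 -> 'I_fb_rank1.+1 -> 'I_fb_rank1.+1 -> nat;
  fb_star : 'I_fb_rank1.+1 -> 'I_fb_rank1.+1;
  fb_coordK : cancel fb_coord (zcomb fb_elt);
  fb_zcombK : cancel (zcomb fb_elt) fb_coord;
  fb_one : fb_elt ord0 = 1;
  fb_mul : forall i j,
    fb_elt i * fb_elt j = \sum_k fb_elt k *+ fb_str i j k;
  fb_starK : involutive fb_star;
  fb_star_anti : ring_antiautomorphism
    (fun x => zcomb (fun j => fb_elt (fb_star j)) (fb_coord x));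
  fb_str_one : forall i j, fb_str i j ord0 = (i == fb_star j)
}.

Arguments fb_coord {R} B x : rename.
Arguments fb_str {R} B i j k : rename.
Arguments fb_star {R} B i : rename.

Definition fb_rank (R : nzRingType) (B : fusionBasis R) : nat :=
  (fb_rank1 B).+1.

Notation fb_index B := 'I_(fb_rank B).

Section FPdim.
Local Open Scope classical_set_scope.
Variable K : realType.

Definition max_real_eigenvalue (n : nat) (M : 'M[K]_n) : K :=
  let E := [set x : K | eigenvalue M x] in xget 0 (E `&` ubound E).

Variables (R : nzRingType) (B : fusionBasis R).

Definition fusion_mx (i : fb_index B) : 'M[K]_(fb_rank B) :=
  \matrix_(j, k) (fb_str B i j k)%:R.

(* The Z-linear map with the prescribed values on B.  Those values being real,
   it is taken with values in the real numbers rather than in C. *)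
Definition FPdim (x : R) : K :=
  \sum_i (fb_coord B x i)%:~R * max_real_eigenvalue (fusion_mx i).

Definition FPdim_ring : K := \sum_(i < fb_rank B) FPdim (B i) ^+ 2.

End FPdim.

Arguments FPdim K {R} B x.
Arguments FPdim_ring K {R} B.

(* The subring S is the subtype fs_ring of R cut out by fs_pred, with
   inclusion val.  Since fs_basis is a Z-basis of S, the set fs_pred is
   exactly the Z-span of C inside R. *)
Record fusionSubring (R : nzRingType) (B : fusionBasis R) := FusionSubring {
  fs_pred : pred R;
  fs_ring : subNzRingType fs_pred;
  fs_basis : fusionBasis fs_ring;
  fs_sub : forall j : fb_index fs_basis,
    exists i : fb_index B, val (fs_basis j) = B i
}.

Definition fs_set (R : nzRingType) (B : fusionBasis R) (S : fusionSubring B) :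
    {set fb_index B} :=
  [set i | [exists j : fb_index (fs_basis S), val (fs_basis S j) == B i]].

Definition near_integral (R : nzRingType) (B : fusionBasis R)
    (S : fusionSubring B) : Prop :=
  (#|fs_set S| + 1 = fb_rank B)%N.

(* Main.v *)
Require Import Defs.
From mathcomp Require Import all_boot all_order all_algebra.
From mathcomp Require Import classical_sets reals.
From mathcomp Require Import ring lra.

Set Implicit Arguments.
Unset Strict Implicit.
Unset Printing Implicit Defensive.

Import Order.TTheory GRing.Theory Num.Theory.
Local Open Scope ring_scope.

(* The Frobenius-Perron dimensions are identified by exhibiting positive
   eigenvectors: a nonnegative matrix with a positive column eigenvector has the
   corresponding eigenvalue as its largest real one, as one sees by pairing that
   vector with the absolute values of any other row eigenvector.  The
   eigenvectors come from the near-integral fusion rules, which follow from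
   associativity and duality: for x in C one has x rho = m(x) rho with m(x) a
   positive integer, m is multiplicative, and rho^2 = kappa rho + sum m(x) x.
   So FPdim x = m(x), and d = FPdim rho is the positive root of
   d^2 = kappa d + N with N = sum m(x)^2.  If d is an integer then
   N = d (d - kappa) with d - kappa >= 1, whence N >= d > kappa; and a rational
   d is an integer, being a root of a monic integer polynomial. *)

Lemma max_real_eigenvalue_pos (K : realType) (n : nat) (M : 'M[K]_n)
    (d : 'I_n -> K) (l : K) :
  (0 < n)%N -> (forall i j, 0 <= M i j) -> (forall i, 0 < d i) ->
  (forall i, \sum_j M i j * d j = l * d i) ->
  max_real_eigenvalue M = l.
Proof.
move=> n_gt0 M_ge0 d_gt0 Md.
have eig_l : eigenvalue M l.
  have : \det (M - l%:M)^T == 0.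
    apply/det0P; exists (\row_j d j).
      apply/eqP => /rowP/(_ (Ordinal n_gt0)); rewrite !mxE => d0.
      by have := d_gt0 (Ordinal n_gt0); rewrite d0 ltxx.
    apply/rowP => i; rewrite !mxE.
    under eq_bigr => j _ do rewrite !mxE mulrBr mulrC.
    rewrite sumrB Md (bigD1 i) //= eqxx mulr1n big1 ?addr0; last first.
      by move=> j ji; rewrite eq_sym (negPf ji) mulr0.
    by rewrite mulrC subrr.
  rewrite det_tr => /det0P[v v_neq0 vM]; apply/eigenvalueP; exists v => //.
  by apply/eqP; rewrite -subr_eq0 -mul_mx_scalar -mulmxBr vM.
have eig_le m : eigenvalue M m -> m <= l.
  move=> /eigenvalueP[v vM v_neq0].
  have le_v k : `|m| * `|v 0 k| <= \sum_j `|v 0 j| * M j k.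
    move/rowP/(_ k): vM; rewrite !mxE => vMk.
    rewrite -normrM -vMk (le_trans (ler_norm_sum _ _ _)) //.
    by apply: ler_sum => j _; rewrite normrM (ger0_norm (M_ge0 j k)).
  have [k vk] : exists k, v 0 k != 0.
    apply/existsP; rewrite -negb_forall; apply: contra v_neq0 => /forallP v0.
    by apply/eqP/rowP => k; rewrite mxE; apply/eqP.
  have pairing_gt0 : 0 < \sum_j `|v 0 j| * d j.
    rewrite (bigD1 k) //= ltr_pwDl ?mulr_gt0 ?normr_gt0 //.
    by apply: sumr_ge0 => j _; rewrite mulr_ge0 // ltW.
  rewrite (le_trans (ler_norm m)) // -(ler_pM2r pairing_gt0) !mulr_sumr.
  have -> : \sum_j l * (`|v 0 j| * d j)
      = \sum_i (\sum_j `|v 0 j| * M j i) * d i.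
    under [RHS]eq_bigr => i _ do rewrite mulr_suml.
    rewrite exchange_big /=; apply: eq_bigr => j _.
    rewrite mulrCA -Md mulr_sumr.
    by apply: eq_bigr => i _; rewrite mulrA.
  by apply: ler_sum => i _; rewrite mulrA ler_pM2r.
rewrite /max_real_eigenvalue; apply: xget_unique.
  by split=> // m /= /eig_le.
move=> m [/= eig_m ub_m]; apply/eqP; rewrite eq_le (eig_le _ eig_m).
exact: ub_m.
Qed.

Section StructureConstants.
Variables (R : nzRingType) (B : fusionBasis R).
Implicit Types i j k l : fb_index B.

Lemma fb_coord_elt i k : fb_coord B (B i) k = (i == k)%:Z.
Proof.
pose a : {ffun fb_index B -> int} := [ffun k => (i == k)%:Z].
suff -> : B i = zcomb B a by rewrite fb_zcombK ffunE.
rewrite /zcomb (bigD1 i) //= big1 ?addr0 ?ffunE ?eqxx // => j ji.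
by rewrite ffunE eq_sym (negPf ji).
Qed.

Lemma fb_coord_sum (f : fb_index B -> nat) k :
  fb_coord B (\sum_i B i *+ f i) k = f k.
Proof.
pose a : {ffun fb_index B -> int} := [ffun k => (f k)%:Z].
suff -> : \sum_i B i *+ f i = zcomb B a by rewrite fb_zcombK ffunE.
by apply: eq_bigr => j _; rewrite ffunE.
Qed.

Lemma fb_elt_inj : injective B.
Proof.
move=> i j eq_ij; apply/eqP; have := fb_coord_elt i j.
by rewrite eq_ij fb_coord_elt eqxx; case: (i == j).
Qed.

Lemma fb_eq_sum (f g : fb_index B -> nat) :
  \sum_i B i *+ f i = \sum_i B i *+ g i -> f =1 g.
Proof. by move=> fg k; apply/eqP; rewrite -eqz_nat -!fb_coord_sum fg. Qed.

Lemma fb_mul_suml (f : fb_index B -> nat) k :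
  (\sum_i B i *+ f i) * B k = \sum_l B l *+ (\sum_i f i * fb_str B i k l).
Proof.
rewrite mulr_suml; under [RHS]eq_bigr => l _ do rewrite -sumrMnr.
rewrite exchange_big /=; apply: eq_bigr => i _.
rewrite mulrnAl fb_mul -sumrMnl; apply: eq_bigr => l _.
by rewrite -mulrnA mulnC.
Qed.

Lemma fb_mul_sumr (f : fb_index B -> nat) k :
  B k * (\sum_i B i *+ f i) = \sum_l B l *+ (\sum_i f i * fb_str B k i l).
Proof.
rewrite mulr_sumr; under [RHS]eq_bigr => l _ do rewrite -sumrMnr.
rewrite exchange_big /=; apply: eq_bigr => i _.
rewrite mulrnAr fb_mul -sumrMnl; apply: eq_bigr => l _.
by rewrite -mulrnA mulnC.
Qed.

Lemma fb_strA i j k l :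
  (\sum_m fb_str B i j m * fb_str B m k l
   = \sum_m fb_str B j k m * fb_str B i m l)%N.
Proof.
move: l; apply: fb_eq_sum.
by rewrite -fb_mul_suml -fb_mul_sumr -!fb_mul mulrA.
Qed.

(* Both sides are the coefficient of 1 in [B i * B j * B k]. *)
Lemma fb_str_cycle i j k :
  fb_str B i j (fb_star B k) = fb_str B j k (fb_star B i).
Proof.
have := fb_strA i j k ord0.
under eq_bigr => m _ do rewrite fb_str_one.
under [RHS]eq_bigr => m _ do rewrite fb_str_one eq_sym (inv_eq (@fb_starK _ B)).
rewrite (bigD1 (fb_star B k)) //= eqxx muln1 big1 ?addn0; last first.
  by move=> m /negPf ->; rewrite muln0.
rewrite (bigD1 (fb_star B i)) //= eqxx muln1 big1 ?addn0 //.
by move=> m /negPf ->; rewrite muln0.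
Qed.

Lemma fb_str_star i j k :
  fb_str B (fb_star B j) (fb_star B i) (fb_star B k) = fb_str B i j k.
Proof.
have [_ _ _ antiM] := fb_star_anti B.
pose F x := zcomb (fun l => B (fb_star B l)) (fb_coord B x).
have FE f : F (\sum_l B l *+ f l) = \sum_l B l *+ f (fb_star B l).
  rewrite /F /zcomb.
  under eq_bigr => l _ do rewrite fb_coord_sum.
  rewrite (reindex_inj (can_inj (@fb_starK _ B))) /=.
  by apply: eq_bigr => l _; rewrite fb_starK.
have FB l : F (B l) = B (fb_star B l).
  rewrite /F /zcomb (bigD1 l) //= fb_coord_elt eqxx big1 ?addr0 // => p pl.
  by rewrite fb_coord_elt eq_sym (negPf pl).
have := antiM (B i) (B j); rewrite /= -/(F _) -/(F (B i)) -/(F (B j)).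
rewrite !FB !fb_mul FE => /fb_eq_sum/(_ (fb_star B k)).
by rewrite fb_starK.
Qed.

End StructureConstants.

Lemma FPdim_elt (K : realType) (R : nzRingType) (B : fusionBasis R)
    (i : fb_index B) :
  FPdim K B (B i) = max_real_eigenvalue (fusion_mx K i).
Proof.
rewrite /FPdim (bigD1 i) //= fb_coord_elt eqxx mul1r big1 ?addr0 // => j ji.
by rewrite fb_coord_elt eq_sym (negPf ji) mul0r.
Qed.

Lemma FPdim_elt_pos (K : realType) (R : nzRingType) (B : fusionBasis R)
    (d : fb_index B -> K) (i : fb_index B) (l : K) :
  (forall j, 0 < d j) ->
  (forall j, \sum_k (fb_str B i j k)%:R * d k = l * d j) ->
  FPdim K B (B i) = l.
Proof.
move=> d_gt0 dM; rewrite FPdim_elt.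
apply: (@max_real_eigenvalue_pos _ _ _ d) => // [j k|j].
  by rewrite mxE ler0n.
by under eq_bigr => k _ do rewrite mxE.
Qed.

Section FusionSubring.
Variables (R : nzRingType) (B : fusionBasis R) (S : fusionSubring B).
Notation C := (fs_basis S).
Implicit Types a b c : fb_index C.

Definition fs_incl a : fb_index B := odflt ord0 [pick i | val (C a) == B i].

Lemma fs_inclE a : val (C a) = B (fs_incl a).
Proof.
rewrite /fs_incl; case: pickP => [i /eqP //|no].
by have [i Ci] := fs_sub a; have := no i; rewrite Ci eqxx.
Qed.

Lemma fs_incl_inj : injective fs_incl.
Proof.
by move=> a b eq_ab; apply/(@fb_elt_inj _ C)/val_inj; rewrite !fs_inclE eq_ab.
Qed.

Lemma fs_incl_ord0 : fs_incl ord0 = ord0.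
Proof. by apply: (@fb_elt_inj _ B); rewrite -fs_inclE !fb_one rmorph1. Qed.

Lemma fs_setP i : reflect (exists a, i = fs_incl a) (i \in fs_set S).
Proof.
rewrite inE; apply: (iffP existsP) => -[a].
  by rewrite fs_inclE => /eqP/fb_elt_inj <-; exists a.
by move=> ->; exists a; rewrite fs_inclE.
Qed.

Lemma mem_fs_incl a : fs_incl a \in fs_set S.
Proof. by apply/fs_setP; exists a. Qed.

Lemma big_fs_set (V : nmodType) (F : fb_index B -> V) :
  \sum_(k in fs_set S) F k = \sum_c F (fs_incl c).
Proof.
have -> : fs_set S = [set fs_incl c | c in [set: fb_index C]].
  apply/setP => k; apply/fs_setP/imsetP => -[c]; first by move=> ->; exists c.
  by move=> _ ->; exists c.
rewrite big_imset => [|c e _ _]; last exact: fs_incl_inj.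
by rewrite big_set.
Qed.

Lemma fs_str_sum a b k :
  fb_str B (fs_incl a) (fs_incl b) k
  = (\sum_c (fs_incl c == k) * fb_str C a b c)%N.
Proof.
move: k; apply: fb_eq_sum.
rewrite -fb_mul -!fs_inclE -rmorphM fb_mul rmorph_sum /=.
under [RHS]eq_bigr => k _ do rewrite -sumrMnr.
rewrite exchange_big; apply: eq_bigr => c _ /=.
rewrite raddfMn /= fs_inclE (bigD1 (fs_incl c)) //= eqxx mul1n big1 ?addr0 //.
by move=> k; rewrite eq_sym => /negPf ->; rewrite mul0n mulr0n.
Qed.

Lemma fs_str_incl a b c :
  fb_str B (fs_incl a) (fs_incl b) (fs_incl c) = fb_str C a b c.
Proof.
rewrite fs_str_sum (bigD1 c) //= eqxx mul1n big1 ?addn0 // => e ec.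
by rewrite (inj_eq fs_incl_inj) (negPf ec).
Qed.

Lemma fs_str_out a b k :
  k \notin fs_set S -> fb_str B (fs_incl a) (fs_incl b) k = 0%N.
Proof.
move=> kS; rewrite fs_str_sum big1 // => c _; case: eqP => // kc.
by rewrite -kc mem_fs_incl in kS.
Qed.

Lemma fs_incl_star a : fs_incl (fb_star C a) = fb_star B (fs_incl a).
Proof.
have := fs_str_incl (fb_star C a) a ord0.
by rewrite fs_incl_ord0 !fb_str_one eqxx; case: eqP.
Qed.

Lemma fs_set_star i : (fb_star B i \in fs_set S) = (i \in fs_set S).
Proof.
apply/idP/idP => /fs_setP[a]; last by move=> ->; rewrite -fs_incl_star mem_fs_incl.
by move=> ia; rewrite -[i](@fb_starK _ B) ia -fs_incl_star mem_fs_incl.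
Qed.

End FusionSubring.

Section NearIntegral.
Variables (R : nzRingType) (B : fusionBasis R) (S : fusionSubring B).
Notation C := (fs_basis S).
Hypothesis hS : near_integral S.
Variable rho : fb_index B.
Hypothesis hrho : rho \notin fs_set S.
Implicit Types i j k : fb_index B.

Lemma near_integral_mem i : (i \in fs_set S) = (i != rho).
Proof.
have le_S : fs_set S \subset ~: [set rho].
  by apply/fintype.subsetP => k kS; rewrite !inE; apply: contraNneq hrho => <-.
have /eqP -> : fs_set S == ~: [set rho].
  rewrite eqEcard le_S cardsC1 card_ord.
  by move/eqP: hS; rewrite addn1 eqSS /= => /eqP ->.
by rewrite !inE.
Qed.

Lemma near_integral_star : fb_star B rho = rho.
Proof. by apply/eqP; rewrite -[_ == _]negbK -near_integral_mem fs_set_star. Qed.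

Lemma str_sub_rho i k :
  i \in fs_set S -> k \in fs_set S -> fb_str B i rho k = 0%N.
Proof.
move=> iS kS; rewrite -[k](@fb_starK _ B) fb_str_cycle fb_str_cycle.
rewrite near_integral_star.
have /fs_setP[a ->] : fb_star B k \in fs_set S by rewrite fs_set_star.
by case/fs_setP: iS => b ->; rewrite fs_str_out.
Qed.

Lemma str_rho_sub i k :
  i \in fs_set S -> k \in fs_set S -> fb_str B rho i k = 0%N.
Proof.
move=> iS kS; rewrite -fb_str_star near_integral_star.
by rewrite str_sub_rho ?fs_set_star.
Qed.

(* For [i] in the subring, [i * rho = rho_mult i * rho], so that [rho_mult i]
   will turn out to be the Frobenius-Perron dimension of [i]. *)
Definition rho_mult i : nat := fb_str B i rho rho.

Lemma str_rho_mult i : fb_str B rho i rho = rho_mult i.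
Proof. by rewrite -{2}near_integral_star fb_str_cycle near_integral_star. Qed.

Lemma rho_mult_star i : rho_mult (fb_star B i) = rho_mult i.
Proof. by rewrite -str_rho_mult -fb_str_star fb_starK near_integral_star. Qed.

Lemma str_rho_rho k : fb_str B rho rho k = rho_mult k.
Proof.
rewrite -[k](@fb_starK _ B) fb_str_cycle near_integral_star str_rho_mult.
by rewrite rho_mult_star fb_starK.
Qed.

Lemma rho_multM i j : i \in fs_set S -> j \in fs_set S ->
  (\sum_k fb_str B i j k * rho_mult k = rho_mult i * rho_mult j)%N.
Proof.
move=> iS jS; rewrite fb_strA (bigD1 rho) //= big1 ?addn0 1?mulnC // => k.
by rewrite -near_integral_mem => kS; rewrite str_sub_rho.
Qed.

Lemma rho_mult_gt0 i : i \in fs_set S -> (0 < rho_mult i)%N.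
Proof.
move=> iS; have mult1 : rho_mult ord0 = 1%N.
  apply/eqP; rewrite -eqz_nat -(fb_coord_sum (fb_str B ord0 rho)) -fb_mul.
  rewrite fb_one mul1r.
  by rewrite fb_coord_elt eqxx.
have := rho_multM iS; move/(_ (fb_star B i)); rewrite fs_set_star => /(_ iS).
rewrite rho_mult_star (bigD1 ord0) //= fb_str_one fb_starK eqxx mult1.
by case: (rho_mult i).
Qed.

Variable K : realType.

Lemma FPdim_fs_elt (a : fb_index C) :
  FPdim K C (C a) = (rho_mult (fs_incl a))%:R.
Proof.
apply: (@FPdim_elt_pos _ _ _ (fun b => (rho_mult (fs_incl b))%:R)) => b.
  by rewrite ltr0n rho_mult_gt0 ?mem_fs_incl.
rewrite -natrM -rho_multM ?mem_fs_incl // natr_sum.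
rewrite [RHS](bigID (mem (fs_set S))) /= [RHS]addrC [in RHS]big1 ?add0r; last first.
  by move=> k kS; rewrite fs_str_out.
by rewrite big_fs_set; apply: eq_bigr => c _; rewrite fs_str_incl natrM.
Qed.

Definition fs_dim : nat := \sum_(k in fs_set S) rho_mult k ^ 2.

Lemma fs_dim_gt0 : (0 < fs_dim)%N.
Proof.
rewrite /fs_dim (bigD1 (fs_incl (ord0 : fb_index C))) ?mem_fs_incl //=.
by rewrite addn_gt0 expn_gt0 rho_mult_gt0 ?mem_fs_incl.
Qed.

Lemma FPdim_ring_fs : FPdim_ring K C = fs_dim%:R.
Proof.
rewrite /FPdim_ring /fs_dim natr_sum.
by rewrite big_fs_set; apply: eq_bigr => c _; rewrite FPdim_fs_elt natrX.
Qed.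

Lemma FPdim_rho (t : K) :
  0 < t -> t ^+ 2 = (fb_str B rho rho rho)%:R * t + fs_dim%:R ->
  FPdim K B (B rho) = t.
Proof.
move=> t_gt0 tE.
pose d k : K := if k == rho then t else (rho_mult k)%:R.
apply: (@FPdim_elt_pos _ _ _ d) => j.
  rewrite /d; case: eqP => // /eqP; rewrite -near_integral_mem => jS.
  by rewrite ltr0n rho_mult_gt0.
rewrite (bigD1 rho) //= {1 3}/d eqxx.
have [->|] := eqVneq j rho.
  rewrite -expr2 tE /fs_dim natr_sum; congr (_ + _).
  apply: eq_big => k; first by rewrite near_integral_mem.
  by rewrite /d => /negPf ->; rewrite str_rho_rho natrX expr2.
rewrite -near_integral_mem => jS; rewrite str_rho_mult big1 ?addr0 1?mulrC //.
by move=> k; rewrite -near_integral_mem => kS; rewrite str_rho_sub ?mul0r.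
Qed.

End NearIntegral.

Lemma rat_root_monic_quadratic (q : rat) (b c : int) :
  q ^+ 2 = b%:~R * q + c%:~R -> q \is a Num.int.
Proof.
move=> qE; rewrite Qint_def.
have den0 : (denq q)%:~R != 0 :> rat by rewrite intr_eq0 denq_neq0.
have /eqP : (numq q ^+ 2)%:~R
    = ((b * numq q + c * denq q) * denq q)%:~R :> rat.
  rewrite rmorphXn rmorphM rmorphD !rmorphM /=.
  have -> : (numq q)%:~R = q * (denq q)%:~R :> rat.
    by rewrite -{2}[q]divq_num_den divfK.
  by rewrite exprMn qE; ring.
rewrite eqr_int => /eqP numE.
have : (denq q %| numq q ^+ 2)%Z by rewrite numE dvdz_mull.
rewrite -[numq q ^+ 2]mulr1 Gauss_dvdzr; last first.
  by rewrite coprimezXr // coprimez_sym /coprimez; apply: coprime_num_den.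
by rewrite dvdz1 -eqz_nat absz_denq.
Qed.

Theorem lemma3p2 (K : realType) (R : nzRingType) (B : fusionBasis R)
    (S : fusionSubring B) (hS : near_integral S)
    (rho : fb_index B) (hrho : rho \notin fs_set S) :
  let kappa : nat := fb_str B rho rho rho in
  let N : K := FPdim_ring K (fs_basis S) in
  let dplus : K := FPdim K B (B rho) in
  (dplus \is a Num.int -> kappa%:R < N) /\
  (N <= kappa%:R -> @irrational K dplus).
Proof.
move=> kappa N dplus.
pose n := fs_dim S rho.
have NE : N = n%:R by exact: FPdim_ring_fs.
have n_gt0 : 0 < n%:R :> K by rewrite ltr0n fs_dim_gt0.
have k_ge0 : 0 <= kappa%:R :> K by rewrite ler0n.
have disc_ge0 : 0 <= kappa%:R ^+ 2 + 4 * n%:R :> K by nra.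
pose s : K := Num.sqrt (kappa%:R ^+ 2 + 4 * n%:R).
have s2 : s ^+ 2 = kappa%:R ^+ 2 + 4 * n%:R by rewrite sqr_sqrtr.
have s_gt0 : 0 < s by rewrite sqrtr_gt0; nra.
pose t : K := (kappa%:R + s) / 2.
have tE : t ^+ 2 = kappa%:R * t + n%:R by rewrite /t; lra.
have t_gt0 : 0 < t by rewrite /t; lra.
have dE : dplus = t by apply: (FPdim_rho hS hrho t_gt0 tE).
have int_lt : t \is a Num.int -> kappa%:R < n%:R :> K.
  case/intrP => z tz.
  have lt_kt : kappa%:R < t.
    by rewrite -(ltr_pM2r t_gt0) -expr2 tE ltrDl.
  have le_kt : kappa%:R + 1 <= t.
    move: lt_kt; rewrite tz -[kappa%:R]/(kappa%:Z%:~R) ltr_int.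
    by rewrite -[1]/(1%:~R) -intrD ler_int lezD1.
  have : n%:R = t * (t - kappa%:R) by rewrite mulrBr -expr2 tE; ring.
  nra.
rewrite NE dE; split=> // le_nk [q _ qt].
have q_int : q \is a Num.int.
  apply: (@rat_root_monic_quadratic _ kappa n).
  apply: (fmorph_inj (@ratr K)).
  by rewrite rmorphXn rmorphD rmorphM /= !ratr_int qt.
suff /int_lt : t \is a Num.int by rewrite ltNge le_nk.
by case/intrP: q_int qt => z -> <-; rewrite ratr_int intr_int.
Qed.
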